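(* For every positive integer $n$, there exists a function $f:\mathbb{R}_+\to\mathbb{R}_+$ such that if $\mathcal{F}$ is the class of the intersection graphs of finite $f$-space-filling families of subsets of $\mathbb{R}^n$ (with the Euclidean metric), then $\operatorname{asdim}(\mathcal{F})\ge n+1$.
   Context: Families are multisets. The intersection graph of a family $\mathcal{A}$ of sets is the simple graph with vertex set $\mathcal{A}$ in which two distinct vertices (members) $S_1,S_2$ are adjacent iff $S_1\cap S_2\neq\emptyset$. For $f:\mathbb{R}_+\to\mathbb{R}_+$, a family $\mathcal{S}$ of subsets of a metric space $(X,d)$ is $f$-space-filling if every member of $\mathcal{S}$ has finite diameter, and for all real $r,s>0$ and all $x\in X$, the ball $B(x,r)=\{y\in X: d(x,y)\le r\}$ is intersected by at most $f(r/s)$ pairwise disjoint members of $\mathcal{S}$ of diameter at least $s$ (that is, any collection of pairwise disjoint members of $\mathcal{S}$, each of diameter at least $s$ and each meeting $B(x,r)$, has size at most $f(r/s)$). A graph $G$ is viewed as an extended metric space (distances may be $+\infty$) $(V(G),\operatorname{dist}_G)$, where $\operatorname{dist}_G(u,v)$ is the infimum of the number of edges of paths between $u$ and $v$. In an extended metric space $(X,d)$: $\operatorname{diam}(U)=\sup_{x,y\in U}d(x,y)$; for $r>0$ a collection $\mathcal{U}$ of subsets is $r$-disjoint if $\inf_{u\in U,u'\in U'}d(u,u')>r$ for all distinct $U,U'\in\mathcal{U}$. For an integer $m\ge 0$, a function $g:\mathbb{R}_+\to\mathbb{R}_+$ is an $m$-dimensional control function for $(X,d)$ if for every positive integer $r$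 there is a cover $\mathcal{U}=\bigcup_{i=1}^{m+1}\mathcal{U}_i$ of $X$ with $\operatorname{diam}(U)\le g(r)$ for all $U\in\mathcal{U}$ and each $\mathcal{U}_i$ being $r$-disjoint. A class $\mathcal{G}$ of graphs has asymptotic dimension at most $m$ if some single function $g:\mathbb{R}_+\to\mathbb{R}_+$ is an $m$-dimensional control function for all graphs in $\mathcal{G}$; $\operatorname{asdim}(\mathcal{G})$ is the least such integer $m\ge 0$ ($\infty$ if none exists). *)

(* Defs.v *)
From mathcomp Require Import all_boot all_order all_algebra.
From mathcomp Require Import all_classical all_reals.
From mathcomp Require Import interval_inference ereal.

Set Implicit Arguments.
Unset Strict Implicit.
Unset Printing Implicit Defensive.

Import Order.TTheory GRing.Theory Num.Theory.

Local Open Scope classical_set_scope.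
Local Open Scope ring_scope.

(* Extended metric spaces are given by a carrier X and d : X -> X -> \bar R. *)

Section ExtendedMetric.
Context {R : realType} {X : Type}.
Implicit Types (d : X -> X -> \bar R) (U : set X) (UU : set (set X)).

(* The diameter of the empty set is -oo; this is harmless below, where
   diameters are only compared with +oo, with s > 0 and with g r >= 0. *)
Definition diam d U : \bar R := ereal_sup [set d x y | x in U & y in U].

Definition r_disjoint d (r : R) UU : Prop :=
  forall U U', UU U -> UU U' -> U <> U' ->
    (r%:E < ereal_inf [set d u u' | u in U & u' in U'])%E.

Definition control_function (m : nat) (g : {nonneg R} -> {nonneg R}) d : Prop :=
  forall r : nat, (0 < r)%N ->
  exists UU : 'I_m.+1 -> set (set X),
    [/\ cover (\bigcup_i UU i) id = [set: X],
        forall U, (\bigcup_i UU i) U -> (diam d U <= (g r%:R%:nng)%:num%:E)%E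
      & forall i, r_disjoint d r%:R (UU i)].

End ExtendedMetric.

Record sgraph := SGraph {
  vertex : choiceType;
  edge : rel vertex;
  edge_sym : symmetric edge;
  edge_irrefl : irreflexive edge }.

Section AsymptoticDimension.
Variable R : realType.

Definition is_upath (G : sgraph) (u v : vertex G) (p : seq (vertex G)) : Prop :=
  [/\ path (@edge G) u p, last u p = v & uniq (u :: p)].

Definition graph_dist (G : sgraph) (u v : vertex G) : \bar R :=
  ereal_inf [set (size p)%:R%:E | p in is_upath u v].

Definition asdim_at_most (C : sgraph -> Prop) (m : nat) : Prop :=
  exists g : {nonneg R} -> {nonneg R},
    forall G, C G -> control_function m g (@graph_dist G).

Definition asdim (C : sgraph -> Prop) : \bar R :=
  ereal_inf [set m%:R%:E | m in asdim_at_most C].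

End AsymptoticDimension.

(* A finite multiset of subsets of X is a family S : I -> set X indexed by a
   finite type I; the members are the indices. *)

Section IntersectionGraph.
Context {X : Type} {I : finType}.
Variable S : I -> set X.

Definition inter_edge : rel I :=
  fun i j => (i != j) && `[< S i `&` S j !=set0 >].

Lemma inter_edge_sym : symmetric inter_edge.
Proof. by move=> i j; rewrite /inter_edge eq_sym setIC. Qed.

Lemma inter_edge_irrefl : irreflexive inter_edge.
Proof. by move=> i; rewrite /inter_edge eqxx. Qed.

Definition inter_graph : sgraph := SGraph inter_edge_sym inter_edge_irrefl.

End IntersectionGraph.

Section SpaceFilling.
Variable R : realType.

Definition space_filling (f : {nonneg R} -> {nonneg R}) (X : Type)
    (d : X -> X -> R) (I : finType) (S : I -> set X) : Prop :=
  let diamS i := diam (fun x y => (d x y)%:E) (S i) in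
  (forall i, (diamS i < +oo)%E) /\
  forall (r s : {posnum R}) (x : X) (J : {set I}),
    trivIset [set` J] S ->
    (forall i, i \in J ->
       (s%:num%:E <= diamS i)%E /\ S i `&` [set y | d x y <= r%:num] !=set0) ->
    #|J|%:R <= (f (r%:num / s%:num)%:nng)%:num.

(* The library's own norm on 'rV[R]_n is the sup norm. *)
Definition eucl_dist (n : nat) (x y : 'rV[R]_n) : R :=
  Num.sqrt (\sum_(i < n) (x ord0 i - y ord0 i) ^+ 2).

Definition space_filling_graphs (n : nat) (f : {nonneg R} -> {nonneg R}) :
    sgraph -> Prop :=
  fun G => exists (I : finType) (S : I -> set 'rV[R]_n),
     space_filling f (@eucl_dist n) S /\ G = inter_graph S.

End SpaceFilling.

(* Main.v *)
(** The graphs are finite pieces of a dyadic model of hyperbolic (n+1)-space: a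
    vertex (t, a) stands for the cube of side 2^t at 2^t a in R^n, adjacent to the
    cubes touching it at its own level and to its parent.  Each cube is replaced by
    a finite set of points of levels t and t-1, chosen so that points of levels at
    least l are 2^l-separated while a set containing a point of level l has
    diameter O(2^l); a packing argument then gives space-filling.
    A large Euclidean box, with the level as an extra coordinate, maps to such a
    graph by a map which is Lipschitz and sends opposite faces far apart, because
    an edge changes the level by at most 1 and the position by at most 2^T, T being
    the top level.  In a cover by n+1 families of bounded, disjoint sets, the
    members of the i-th family coming close to the far face in direction i do not
    come close to the opposite one.  The n+1 functions h_i indicating those members
    are 0 on one face and 1 on the opposite face in direction i, and on each unit
    cube one of them is constant: this contradicts the fact that the cup product of
    their coboundaries, summed mod 2 over Kuhn's triangulation, equals 1. *)
Require Import Defs.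
From mathcomp Require Import all_boot all_order all_fingroup all_algebra.
From mathcomp Require Import all_classical all_reals.
From mathcomp Require Import interval_inference ereal.
From mathcomp Require Import zify ring lra.

Set Implicit Arguments.
Unset Strict Implicit.
Unset Printing Implicit Defensive.

Import Order.TTheory GRing.Theory Num.Theory.

Local Open Scope classical_set_scope.
Local Open Scope ring_scope.

(** * The covering theorem for a grid *)

Lemma F2_addrr (x : 'F_2) : x + x = 0.
Proof.
by rewrite -mulr2n -mulr_natl (_ : 2%:R = 0 :> 'F_2) ?mul0r //; apply: val_inj.
Qed.

Lemma F2_addr_eq (x y : 'F_2) : x + y = 0 -> x = y.
Proof. by move=> xy; rewrite -[x]addr0 -(F2_addrr y) addrA xy add0r. Qed.

(** * Cup products of mod 2 cochains *)

Section Cochains.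
Variable P : Type.
Implicit Types (x : nat -> P) (c : nat -> P -> P -> 'F_2) (k : P -> 'F_2).

(* The coboundary mod 2 of a cochain [w] of degree [l], which reads only the
   first [l.+1] vertices of an infinite sequence. *)
Definition coboundary (l : nat) (w : (nat -> P) -> 'F_2) x : 'F_2 :=
  \sum_(m < l.+2) w (x \o bump m).

Definition cocycle1 (c : P -> P -> 'F_2) := forall y z t, c y t = c y z + c z t.

Definition cup c l x : 'F_2 := \prod_(j < l) c j (x j) (x j.+1).

Lemma cupS c l x :
  cup c l.+1 x = c 0 (x 0) (x 1) * cup (c \o succn) l (x \o succn).
Proof. by rewrite /cup big_ord_recl. Qed.

(** Leibniz rule: faces 0 and 1 carry the factors [c (x 1) (x 2)] and [c (x 0) (x 2)], whose sum is
    [c (x 0) (x 1)] by the cocycle identity; all later faces keep the edge from [x 0] to [x 1]. *)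
Lemma coboundary_cup1 (c : P -> P -> 'F_2) l (w : (nat -> P) -> 'F_2) x :
  cocycle1 c ->
  coboundary l.+1 (fun y => c (y 0) (y 1) * w (y \o succn)) x =
  c (x 0) (x 1) * coboundary l w (x \o succn).
Proof.
move=> cC; rewrite /coboundary 2!big_ord_recl [in RHS]big_ord_recl /= mulrDr.
rewrite addrA; congr (_ + _).
  have -> : (x \o bump 0) \o succn = (x \o succn) \o bump 0 by [].
  have -> : (x \o bump (bump 0 0)) \o succn = (x \o succn) \o bump 0 by [].
  rewrite -mulrDl; congr (_ * _).
  by rewrite /= (cC (x 0) (x 1) (x 2)) addrCA F2_addrr addr0.
rewrite big_distrr /=; apply: eq_bigr => m _; congr (_ * w _).
by apply/funext => j /=; rewrite /bump !add1n ltnS addnS.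
Qed.

Lemma coboundary_cup c l x :
  (forall j, cocycle1 (c j)) -> coboundary l (cup c l) x = 0.
Proof.
elim: l c x => [|l IH] c x cC.
  by rewrite /coboundary !big_ord_recl big_ord0 /cup !big_ord0 addr0 F2_addrr.
rewrite (_ : cup c l.+1 =
  fun y => c 0 (y 0) (y 1) * cup (c \o succn) l (y \o succn)); last first.
  by apply/funext => y; rewrite cupS.
by rewrite coboundary_cup1// IH ?mulr0// => j; exact: cC.
Qed.

(** Every face but the first keeps the vertex [x 0], so [k (x 0)] factors out; the remaining sum
    equals the term of the first face because [cup c l] is a cocycle. *)
Lemma coboundary_cup0 k c l x : (forall j, cocycle1 (c j)) ->
  coboundary l (fun y => k (y 0) * cup c l y) x =
  (k (x 1) + k (x 0)) * cup c l (x \o succn).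
Proof.
move=> cC; have := coboundary_cup l x cC.
rewrite /coboundary big_ord_recl => /F2_addr_eq e.
rewrite big_ord_recl mulrDl /=; congr (_ + _).
by rewrite [in RHS](_ : x \o succn = x \o bump 0)// e big_distrr.
Qed.

Lemma cup_split c i l x : cup c (i + l.+1) x =
  cup c i x * (c i (x i) (x i.+1) *
               cup (fun j => c (i.+1 + j)) l (x \o addn i.+1)).
Proof.
rewrite /cup big_split_ord /= big_ord_recl /= addn0; congr (_ * (_ * _)).
by apply: eq_bigr => j _ /=; rewrite /bump /= !add1n addnS addSn addnS.
Qed.

(** Inserting a 0-cochain [k] between two cup products gives a primitive of the product whose factor
    at position [i] is the coboundary of [k]. *)
Definition cup_mid c k c' i l x := cup c i x * (k (x i) * cup c' l (x \o addn i)).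

Lemma coboundary_cup_mid c k c' i l x :
  (forall j, cocycle1 (c j)) -> (forall j, cocycle1 (c' j)) ->
  coboundary (i + l) (cup_mid c k c' i l) x =
  cup c i x * ((k (x i.+1) + k (x i)) * cup c' l (x \o addn i.+1)).
Proof.
move=> + c'C; elim: i c x => [|i IH] c x cC.
  rewrite add0n /cup big_ord0 mul1r -(coboundary_cup0 k l x c'C).
  by apply: eq_bigr => m _; rewrite /cup_mid /cup big_ord0 mul1r.
rewrite (_ : cup_mid c k c' i.+1 l =
  fun y => c 0 (y 0) (y 1) * cup_mid (c \o succn) k c' i l (y \o succn)).
  by rewrite addSn coboundary_cup1// IH ?cupS ?mulrA// => j; exact: cC.
by apply/funext => y; rewrite /cup_mid cupS -mulrA.
Qed.

End Cochains.

(** * Stokes' theorem and degree on Kuhn's triangulation *)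

Section Kuhn.
Variables (d N : nat).
Local Notation pt := {ffun 'I_d -> nat}.
Local Notation cell := {ffun 'I_d -> 'I_N}.
Implicit Types (q : 'S_d) (v : cell) (x : nat -> pt).

(* The [k]-th vertex of the simplex of Kuhn's triangulation with base point [w],
   where coordinate [i] is incremented at step [q i]. *)
Definition kuhn (w : 'I_d -> nat) q (k : nat) : pt := [ffun i => (w i + (q i < k))%N].

(** Without its vertex [m], a simplex forgets the order of steps [m - 1] and [m]. Exchanging these
    steps pairs the permutations, one odd and one even, and the two terms cancel mod 2. *)
Lemma sum_perm_face0 (w : 'I_d -> nat) (om : (nat -> pt) -> 'F_2) (m : nat) :
  (0 < m < d)%N -> \sum_q om (kuhn w q \o bump m) = 0.
Proof.
case: m => // m /= md.
pose t := tperm (Ordinal (ltnW md)) (Ordinal md).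
have tE q : kuhn w (q * t)%g \o bump m.+1 = kuhn w q \o bump m.+1.
  apply/funext => k /=; apply/ffunP => i; rewrite !ffunE permM /t.
  congr (_ + nat_of_bool _)%N; rewrite /bump.
  by case: tpermP => [->|->|//] /=; case: ltnP => mk /=; lia.
rewrite (bigID (fun q => odd_perm q)) /=.
rewrite [X in X + _](reindex_inj (mulIg t)) /=.
under eq_bigr do rewrite tE.
under eq_bigl => q.
  rewrite odd_permM odd_tperm -val_eqE /= neq_ltn ltnSn /= addbT; over.
by rewrite F2_addrr.
Qed.

(* A cyclic shift of the coordinate [a] permutes the cells, and it moves cells to
   their neighbours except across the two faces, where [F] vanishes. *)
Lemma sum_cell_shift (F : ('I_d -> nat) -> 'F_2) (a : 'I_d) :
  (forall w : 'I_d -> nat, w a = 0 \/ w a = N -> F w = 0) ->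
  \sum_(v : cell) F (fun i => v i + (i == a))%N = \sum_(v : cell) F (fun i => v i).
Proof.
move=> F0; pose sh v : cell := [ffun i => if i == a then ordS (v i) else v i].
have sh_inj : injective sh.
  move=> v v' /ffunP e; apply/ffunP => i; have := e i; rewrite !ffunE.
  by case: eqP => // _ /ordS_inj.
rewrite [RHS](reindex_inj sh_inj) /=; apply: eq_bigr => v _.
have [vN|vN] := eqVneq (v a).+1 N.
  rewrite !F0//; first by left; rewrite ffunE eqxx /= vN modnn.
  by right; rewrite eqxx addn1.
congr F; apply/funext => i; rewrite ffunE; case: eqP => [->|_]; last by rewrite addn0.
by rewrite addn1 /= modn_small//; have := ltn_ord (v a); lia.
Qed.

Lemma kuhn_stokes (om : (nat -> pt) -> 'F_2) : (0 < d)%N ->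
  (forall x y, (forall k, (k < d)%N -> x k = y k) -> om x = om y) ->
  (forall x (a : 'I_d) c, c = 0%N \/ c = N ->
     (forall k, (k < d)%N -> x k a = c) -> om x = 0) ->
  \sum_(v : cell) \sum_q coboundary d.-1 om (kuhn (fun i => v i) q) = 0.
Proof.
move=> d0 om_loc om_bd.
have stp v : \sum_q coboundary d.-1 om (kuhn (fun i => v i) q) =
  \sum_q om (kuhn (fun i => v i) q \o bump 0) + \sum_q om (kuhn (fun i => v i) q).
  rewrite /coboundary exchange_big big_ord_recl big_ord_recr /=.
  rewrite [X in _ + (X + _)]big1 ?add0r => [|m _]; last first.
    by apply: sum_perm_face0; rewrite /= /bump; have := ltn_ord m; lia.
  congr (_ + _); apply: eq_bigr => q _; apply: om_loc => k kd /=.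
  by congr kuhn; rewrite /bump /=; lia.
under eq_bigr do rewrite stp.
rewrite big_split /=.
suff -> : \sum_(v : cell) \sum_q om (kuhn (fun i => v i) q \o bump 0) =
          \sum_(v : cell) \sum_q om (kuhn (fun i => v i) q) by rewrite F2_addrr.
(* The coordinate [a], last in [q], comes first in [q * cyc]. So the first face of the simplex of
   [q * cyc] at [v] is the last face of the simplex of [q] at [v] shifted by one along [a]. *)
pose cyc : 'S_d := perm (@ordS_inj d).
rewrite exchange_big [RHS]exchange_big /= (reindex_inj (mulIg cyc)) /=.
apply: eq_bigr => q _.
have dlt : (d.-1 < d)%N by rewrite prednK.
pose top := Ordinal dlt; pose a := (q^-1)%g top.
have qa i : (i == a) = (q i == top) by rewrite /a -(inj_eq (@perm_inj _ q)) permKV.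
rewrite -(@sum_cell_shift (fun w => om (kuhn w q)) a); last first.
  move=> w wa; apply: (om_bd _ a (w a)) => // k kd.
  by rewrite ffunE /a permKV /= ltnNge -ltnS prednK// kd addn0.
apply: eq_bigr => v _; apply: om_loc => k kd; apply/ffunP => i.
rewrite /= !ffunE permM permE /= -addnA qa -val_eqE /=; congr (_ + _)%N.
have := ltn_ord (q i); rewrite /bump /=.
have [->|qd] := eqVneq (q i : nat) d.-1.
  by rewrite prednK// modnn => _; lia.
by move=> qi; rewrite modn_small; lia.
Qed.

Definition diff1 (h : nat -> pt -> 'F_2) j (y z : pt) : 'F_2 := h j z + h j y.

Lemma diff1_cocycle h j : cocycle1 (diff1 h j).
Proof.
by move=> y z t; rewrite /diff1 [RHS]addrC -[RHS]addrA (addrA (h j z)) F2_addrr add0r.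
Qed.

Definition separates_faces (h : nat -> pt -> 'F_2) := forall (i : 'I_d) (y : pt),
  (y i = 0%N -> h i y = 0) /\ (y i = N -> h i y = 1).

(* The sum of the cup product of the coboundaries of the [h i] over all simplices
   of the triangulated cube; by Stokes it depends only on the boundary values. *)
Definition kuhn_degree h : 'F_2 :=
  \sum_(v : cell) \sum_q cup (diff1 h) d (kuhn (fun i => v i) q).

(** The two products differ by the coboundary of a [cup_mid] with [k = h i + h' i]. It vanishes on
    the boundary: on a face in direction [a != i] the factor [diff1 h a] is zero, and in direction
    [i] the functions [h i] and [h' i] agree. *)
Lemma kuhn_degree_replace h h' i : (i < d)%N -> (forall j, j != i -> h j = h' j) ->
  separates_faces h -> separates_faces h' -> kuhn_degree h = kuhn_degree h'.
Proof.
move=> id hh' hF h'F; apply: F2_addr_eq.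
pose l := (d.-1 - i)%N; pose k y := h i y + h' i y.
pose c' j := diff1 h (i.+1 + j).
have dE : d = (i + l.+1)%N by rewrite /l; lia.
have dE1 : d.-1 = (i + l)%N by rewrite /l; lia.
have cE x : cup (diff1 h) d x + cup (diff1 h') d x =
    coboundary d.-1 (cup_mid (diff1 h) k c' i l) x.
  have cupd c : cup c d x = cup c (i + l.+1) x by rewrite -dE.
  have -> w : coboundary d.-1 w x = coboundary (i + l) w x by rewrite -dE1.
  rewrite !cupd coboundary_cup_mid; first last.
  - by move=> j; exact: diff1_cocycle.
  - by move=> j; exact: diff1_cocycle.
  rewrite !cup_split.
  have -> : cup (diff1 h') i x = cup (diff1 h) i x.
    by apply: eq_bigr => j _; rewrite /diff1 hh'// neq_ltn ltn_ord.
  have -> : cup (fun j => diff1 h' (i.+1 + j)) l (x \o addn i.+1) =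
            cup c' l (x \o addn i.+1).
    apply: eq_bigr => j _; rewrite /c' /diff1 hh'//.
    by rewrite neq_ltn orbC addSn ltnS leq_addr.
  by rewrite -mulrDr -mulrDl /k /diff1 addrACA.
rewrite /kuhn_degree -big_split /=; under eq_bigr do rewrite -big_split /=.
under eq_bigr do under eq_bigr do rewrite cE.
apply: kuhn_stokes; first by lia.
  move=> x y xy; rewrite /cup_mid; congr (_ * (k _ * _)); last 2 first.
  - exact: xy.
  - by apply: eq_bigr => j _ /=; rewrite !xy//; have := ltn_ord j; lia.
  by apply: eq_bigr => j _ /=; rewrite !xy//; have := ltn_ord j; lia.
have cst (a : 'I_d) (y z : pt) c : c = 0%N \/ c = N -> y a = c -> z a = c ->
    diff1 h a y z = 0.
  move=> [] -> ya za; rewrite /diff1.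
    by rewrite (hF a y).1// (hF a z).1// F2_addrr.
  by rewrite (hF a y).2// (hF a z).2// F2_addrr.
move=> x a c c0N xa; rewrite /cup_mid; case: (ltngtP a i) => ai.
- rewrite /cup (bigD1 (Ordinal ai))//= (cst _ _ _ c)// ?mul0r//; apply: xa; lia.
- have ail : (a - i.+1 < l)%N by have := ltn_ord a; rewrite /l; lia.
  rewrite /cup [X in _ * (_ * X)](bigD1 (Ordinal ail))//= /c' subnKC//.
  by rewrite (cst _ _ _ c) ?mul0r ?mulr0//; apply: xa; have := ltn_ord a; lia.
- have xia : x i a = c by exact: xa.
  rewrite (_ : k (x i) = 0) ?mul0r ?mulr0// /k -ai.
  case: c0N => c0; move: xia; rewrite c0 ai => xia.
    by rewrite -ai (hF a _).1 ?ai// -ai (h'F a _).1 ?ai// addr0.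
  by rewrite -ai (hF a _).2 ?ai// -ai (h'F a _).2 ?ai// F2_addrr.
Qed.

Definition coord_pos j (y : pt) : 'F_2 :=
  if insub j is Some i then ((0 < y i)%N : nat)%:R else 0.

Lemma coord_posE (i : 'I_d) y : coord_pos i y = ((0 < y i)%N : nat)%:R.
Proof. by rewrite /coord_pos valK. Qed.

(** Only one simplex contributes: the one of the identity permutation in the cell at the origin. *)
Lemma kuhn_degree_coord_pos : (0 < N)%N -> kuhn_degree coord_pos = 1.
Proof.
move=> N0; have dE v q (j : 'I_d) :
    diff1 coord_pos j (kuhn (fun i => v i) q j) (kuhn (fun i => v i) q j.+1) =
    ((v j == 0 :> nat) && (q j == j) : nat)%:R.
  rewrite /diff1 !coord_posE !ffunE -val_eqE /=.
  case: (v j : nat) => [|m]; last by rewrite !addSn /= F2_addrr.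
  rewrite !add0n [(q j < j.+1)%N]ltnS.
  by case: (ltngtP (q j) j) => _ /=; rewrite ?F2_addrr ?addr0.
pose v0 : cell := [ffun=> Ordinal N0].
rewrite /kuhn_degree (bigD1 v0)//= [X in _ + X]big1 => [|v vv0]; last first.
  apply: big1 => q _; have [j vj] : exists j, v j != 0 :> nat.
    apply/existsP; apply: contra_neqT vv0 => /existsPn vj; apply/ffunP => j.
    by apply: val_inj; rewrite ffunE /=; have := vj j; rewrite negbK => /eqP.
  by rewrite /cup (bigD1 j)//= dE (negbTE vj) mul0r.
rewrite (bigD1 1%g)//= [X in _ + X + _]big1 => [|q q1]; last first.
  have [j qj] : exists j, q j != j.
    apply/existsP; apply: contra_neqT q1 => /existsPn qj; apply/permP => j.
    by rewrite perm1; have := qj j; rewrite negbK => /eqP.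
  by rewrite /cup (bigD1 j)//= dE (negbTE qj) andbF mul0r.
by rewrite /cup big1 ?addr0// => j _; rewrite dE ffunE perm1 !eqxx.
Qed.

Lemma kuhn_degree1 h : (0 < N)%N -> separates_faces h -> kuhn_degree h = 1.
Proof.
move=> N0 hF; rewrite -(kuhn_degree_coord_pos N0).
(* [H] passes from [h] to [coord_pos] by replacing one function at a time. *)
pose H m j := if (j < m)%N then coord_pos j else h j.
have HF m : separates_faces (H m).
  move=> i y; rewrite /H; case: ifP => _; last exact: hF.
  by rewrite coord_posE; split => ->//; rewrite N0.
have -> : kuhn_degree h = kuhn_degree (H 0%N) by [].
have -> : kuhn_degree coord_pos = kuhn_degree (H d).
  rewrite /kuhn_degree; apply: eq_bigr => v _; apply: eq_bigr => q _.
  by apply: eq_bigr => j _; rewrite /diff1 /H ltn_ord.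
have : (d <= d)%N by [].
elim: {-2}d => // m IH md; rewrite IH ?(ltnW md)//.
apply: (@kuhn_degree_replace _ _ m) => // j jm; rewrite /H ltnS.
by case: (ltngtP j m) jm.
Qed.

(** If on each cell some [h i] were constant, every cup product would have a zero factor and the
    degree would be 0 instead of 1. *)
Lemma exists_mixed_cell (h : 'I_d -> pt -> bool) : (0 < N)%N ->
  (forall i (y : pt), y i = 0%N -> ~~ h i y) -> (forall i (y : pt), y i = N -> h i y) ->
  exists v : pt, forall i, exists y z : pt,
    [/\ forall j, (v j <= y j <= (v j).+1)%N,
        forall j, (v j <= z j <= (v j).+1)%N & h i y != h i z].
Proof.
move=> N0 h0 hN.
pose h' j y : 'F_2 := if insub j is Some i then (h i y : nat)%:R else 0.
have h'E (i : 'I_d) y : h' i y = (h i y : nat)%:R by rewrite /h' valK.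
have /(kuhn_degree1 N0) deg1 : separates_faces h'.
  by move=> i y; rewrite h'E; split=> [/h0/negbTE|/hN] ->.
apply: contrapT => no; suff : kuhn_degree h' = 0 by rewrite deg1 => /eqP.
apply: big1 => v _; apply: big1 => q _; apply: contrapT => /eqP.
move=> /prodf_neq0 p0; apply: no; exists [ffun i => v i : nat] => i.
exists (kuhn (fun i => v i) q i), (kuhn (fun i => v i) q i.+1).
split=> [j|j|]; rewrite ?ffunE; [lia..|].
have := p0 i isT; rewrite /diff1 !h'E.
by apply: contra_neq => ->; rewrite F2_addrr.
Qed.

End Kuhn.

(** * Control functions and grids *)

Section Reach.
Variable G : sgraph.
Implicit Types (u v w : vertex G) (k : nat).

(** Walks may repeat vertices, so they concatenate freely; shortening turns them into the paths of
    [graph_dist]. *)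
Definition reach k u v :=
  exists p, [/\ path (@edge G) u p, last u p = v & (size p <= k)%N].

Lemma reach_refl k u : reach k u u.
Proof. by exists [::]. Qed.

Lemma reach_edge u v : edge u v -> reach 1 u v.
Proof. by move=> uv; exists [:: v]; rewrite /= uv. Qed.

Lemma reach_sym k u v : reach k u v -> reach k v u.
Proof.
move=> [p [up <- pk]]; exists (rev (belast u p)); split.
- by rewrite rev_path (eq_path (e' := @edge G)) // => y z; exact: edge_sym.
- by case: p {up pk} => //= y p; rewrite rev_cons last_rcons.
- by rewrite size_rev size_belast.
Qed.

Lemma reach_trans k k' u v w : reach k u v -> reach k' v w -> reach (k + k') u w.
Proof.
move=> [p [up upv pk]] [q [vq vqw qk]]; exists (p ++ q).
by rewrite cat_path last_cat upv up vq size_cat leq_add.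
Qed.

Lemma reach_lipschitz (f : vertex G -> nat) M k u v :
  (forall y z, edge y z -> f z <= f y + M)%N -> reach k u v -> (f v <= f u + k * M)%N.
Proof.
move=> fM [p [+ <- +]]; elim: p u k => [|y p IH] u k /=; first by rewrite leq_addr.
case: k => // k /andP[/fM uy yp pk]; have := IH _ _ yp pk; rewrite mulSn; lia.
Qed.

Lemma reach_graph_dist (R : realType) k u v :
  reach k u v -> (graph_dist R u v <= k%:R%:E)%E.
Proof.
move=> [p [up <- pk]]; case/shortenP: up => p' up' p'u p'p.
apply: ge_ereal_inf; exists (size p')%:R%:E; first by exists p'.
rewrite lee_fin ler_nat (leq_trans _ pk)//.
by have /andP[_ /uniq_leq_size] := p'u; exact.
Qed.

Lemma graph_dist_reach (R : realType) k u v :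
  (graph_dist R u v < k%:R%:E)%E -> reach k u v.
Proof.
move=> /ereal_inf_lt[_ [p [up upv _]] <-]; rewrite lte_fin ltr_nat => pk.
by exists p; split => //; exact: ltnW.
Qed.

End Reach.

(* A vertex of the grid is counted by [h i] when it is close to a member of the
   [i]-th family which also comes close to the far face in direction [i]. *)
Lemma not_control_function (R : realType) (G : sgraph) (n N D m r : nat)
    (phi : {ffun 'I_n.+1 -> nat} -> vertex G) (g : {nonneg R} -> {nonneg R}) :
  (m <= n)%N -> (0 < N)%N -> (4 <= r)%N -> (g r%:R%:nng)%:num < D%:R ->
  (forall y z : {ffun 'I_n.+1 -> nat}, (forall i, y i <= z i <= (y i).+1)%N ->
    reach 2 (phi y) (phi z)) ->
  (forall (i : 'I_n.+1) (y z : {ffun 'I_n.+1 -> nat}), y i = 0%N -> z i = N ->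
    ~ reach (D + 4) (phi y) (phi z)) ->
  ~ control_function m g (graph_dist R (G := G)).
Proof.
move=> mn N0 r4 gD cellP faceP /(_ r (leq_trans _ r4))[] // UU [UUc UUd UUr].
pose near2 (U : set (vertex G)) y := exists2 u, U u & reach 2 (phi y) u.
(* The clause [y i = N] makes [h i] hold on the far face even where the [i]-th family has no member
   nearby. For [i > m], [inord i] is the default index 0. *)
pose h (i : 'I_n.+1) (y : {ffun 'I_n.+1 -> nat}) := `[< y i = N \/
  exists U, UU (inord i) U /\ near2 U y /\
  exists2 w : {ffun 'I_n.+1 -> nat}, w i = N & near2 U w >].
have [||v vP] := @exists_mixed_cell n.+1 N h N0.
- move=> i y yi; apply/asboolPn => -[|[U [UUi [[a Ua ya] [w wi [b Ub wb]]]]]].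
    by rewrite yi => N0'; move: N0; rewrite -N0'.
  apply: (faceP i y w) => //; rewrite (_ : D + 4 = 2 + (D + 2))%N; last by lia.
  apply: reach_trans ya _; apply: reach_trans (reach_sym wb).
  apply: (@graph_dist_reach _ R).
  apply: (@le_lt_trans _ _ (g r%:R%:nng)%:num%:E); last by rewrite lte_fin.
  apply: (@le_trans _ _ (diam (graph_dist R (G:=G)) U)); last first.
    by apply: UUd; exists (inord i).
  by apply: ereal_sup_ubound; exists a => //; exists b.
- by move=> i y yN; apply/asboolP; left.
(* The member [U] containing [phi v] is close to the whole cell, so [h j] will be constant there:
   another member of family [j] close to a vertex of the cell would be within 2 + 2 of [U]. *)
have [U [j _ UUj] Uv] : cover (\bigcup_i UU i) id (phi v) by rewrite UUc.
have jn : (j < n.+1)%N by rewrite (leq_trans (ltn_ord j)).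
have [y [z [vy vz]]] := vP (Ordinal jn).
have ij : inord (Ordinal jn) = j by apply: val_inj; rewrite /= inordK.
have nearU (y' : {ffun 'I_n.+1 -> nat}) :
    (forall i, v i <= y' i <= (v i).+1)%N -> near2 U y'.
  by move=> /cellP vy'; exists (phi v) => //; exact: reach_sym.
suff himp (y' z' : {ffun 'I_n.+1 -> nat}) : (forall i, v i <= y' i <= (v i).+1)%N ->
    (forall i, v i <= z' i <= (v i).+1)%N ->
    h (Ordinal jn) y' -> h (Ordinal jn) z'.
  move/eqP; apply; apply/idP/idP; exact: himp.
move=> vy' vz' /asboolP hy; apply/asboolP; right; rewrite ij.
exists U; split => //; split; first exact: nearU.
case: hy => [yN|[U' [UUj' [[a U'a ya] farU']]]]; first by exists y' => //; exact: nearU.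
rewrite ij in UUj'; suff -> : U = U' by [].
apply: contrapT => UU'; have := UUr j _ _ UUj UUj' UU'.
apply/negP; rewrite -leNgt; apply: ge_ereal_inf.
exists (graph_dist R (phi v) a); first by exists (phi v) => //; exists a.
apply: (@le_trans _ _ 4%:R%:E); last by rewrite lee_fin ler_nat.
by apply: (@reach_graph_dist _ R 4);
  exact: (@reach_trans _ 2 2 _ _ _ (cellP _ _ vy') ya).
Qed.

(** * Space-filling families of dyadic cells *)

Section DyadicCells.
Variables (R : realType) (n : nat).
Implicit Types (a c : 'I_n -> nat) (t l : nat).

(* The coordinates have 2-adic valuation exactly [l], so that points of levels
   at least [l] are 2^l-separated. *)
Definition dyadic_pt l c : 'rV[R]_n := \row_i (2 ^ l * (c i).*2.+1)%:R.

(** Points of level [t] are shared by touching cubes of side [2 ^ t]; a point of level [t - 1] also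
    lies on the cell of the child with index [c]. *)
Definition on_cell t a l c : Prop :=
  (l = t /\ forall i, (a i <= c i <= (a i).+1)%N) \/
  (l.+1 = t /\ forall i, (c i)./2 = a i).

Definition dyadic_cell t a : set 'rV[R]_n :=
  [set p | exists l c, on_cell t a l c /\ p = dyadic_pt l c].

Lemma on_cell_level t a l c : on_cell t a l c -> (l <= t <= l.+1)%N.
Proof. by move=> [[-> _]|[<- _]]; rewrite leqnn leqnSn. Qed.

Lemma on_cell_pos t a l c i : on_cell t a l c ->
  (2 ^ t * a i <= 2 ^ l * c i <= 2 ^ t * a i + 2 ^ l)%N.
Proof.
move=> [[-> /(_ i)/andP[ac ca]]|[<- /(_ i) <-]].
  by rewrite leq_mul2l ac orbT /= -mulnSr leq_mul2l ca orbT.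
rewrite expnSr -mulnA -mulnSr !leq_mul2l mul2n; apply/andP.
by have := odd_double_half (c i); case: odd; lia.
Qed.

(** After division by the smaller power of 2, different levels leave an odd and an even number,
    which differ by at least 1; equal levels leave two odd numbers. *)
Lemma dyadic_nat_inj l l' (c c' : nat) :
  (2 ^ l * c.*2.+1 < 2 ^ l' * c'.*2.+1 + 2 ^ l)%N ->
  (2 ^ l * c.*2.+1 < 2 ^ l' * c'.*2.+1 + 2 ^ l')%N ->
  (2 ^ l' * c'.*2.+1 < 2 ^ l * c.*2.+1 + 2 ^ l)%N ->
  (2 ^ l' * c'.*2.+1 < 2 ^ l * c.*2.+1 + 2 ^ l')%N -> l = l' /\ c = c'.
Proof.
wlog ll' : l l' c c' / (l <= l')%N => [H h1 h2 h3 h4|].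
  case: (leqP l l') => [/H h|/ltnW/H h]; first exact: h.
  by have [-> ->] := h _ _ h4 h3 h2 h1.
move=> h1 _ h3 _; rewrite -(subnK ll') in h1 h3 *.
set k := (l' - l)%N in h1 h3 *; rewrite expnD (mulnC (2 ^ k)%N) in h1 h3.
have l0 : (0 < 2 ^ l)%N by rewrite expn_gt0.
rewrite -!mulnA -mulnSr ltn_pmul2l// in h1; rewrite -!mulnA -mulnSr ltn_pmul2l// in h3.
case: k h1 h3 => [|k]; rewrite ?expn0 ?expnS => h1 h3; first by split; lia.
by lia.
Qed.

Lemma dyadic_pt_sep l l' c c' : (0 < n)%N ->
  (forall i, `|dyadic_pt l c ord0 i - dyadic_pt l' c' ord0 i| < (2 ^ l)%:R /\
             `|dyadic_pt l c ord0 i - dyadic_pt l' c' ord0 i| < (2 ^ l')%:R) ->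
  l = l' /\ c = c'.
Proof.
move=> n0 near; have e i : l = l' /\ c i = c' i.
  have [] := near i; rewrite !mxE !ltr_distl !ltrBlDr -!natrD !ltr_nat.
  by move=> /andP[h1 h2] /andP[h3 h4]; exact: dyadic_nat_inj.
by split; [exact: (e (Ordinal n0)).1 | apply/funext => i; exact: (e i).2].
Qed.

Lemma dyadic_pt_inj l l' c c' : (0 < n)%N ->
  dyadic_pt l c = dyadic_pt l' c' -> l = l' /\ c = c'.
Proof.
move=> n0 e; apply: dyadic_pt_sep => // i.
by rewrite e subrr normr0 !ltr0n !expn_gt0.
Qed.

Lemma ler_coord_eucl_dist (x y : 'rV[R]_n) i :
  `|x ord0 i - y ord0 i| <= eucl_dist x y.
Proof.
rewrite -sqrtr_sqr ler_sqrt ?sumr_ge0// => [|j _]; last exact: sqr_ge0.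
by rewrite (bigD1 i)//= lerDl sumr_ge0// => j _; exact: sqr_ge0.
Qed.

Lemma ler_eucl_dist (x y : 'rV[R]_n) (M : R) :
  (forall i, `|x ord0 i - y ord0 i| <= M) -> eucl_dist x y <= n%:R * M.
Proof.
case: (posnP n) x y => [n0 x y _|n0 x y xyM].
  by rewrite /eucl_dist big1 ?sqrtr0 ?n0 ?mul0r// => i; have := ltn_ord i; rewrite {2}n0.
have M0 : 0 <= M by apply: le_trans (xyM (Ordinal n0)).
rewrite -[leRHS]ger0_norm ?mulr_ge0// -sqrtr_sqr ler_sqrt ?sqr_ge0//.
apply: (@le_trans _ _ (\sum_(i < n) M ^+ 2)).
  by apply: ler_sum => i _; rewrite -real_normK ?num_real// lerXn2r ?nnegrE.
rewrite sumr_const card_ord exprMn -[leLHS]mulr_natl ler_wpM2r ?sqr_ge0//.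
by rewrite expr2 -natrM ler_nat leq_pmulr.
Qed.

Lemma diam_dyadic_cell t a l c : on_cell t a l c ->
  (diam (fun x y => (eucl_dist x y)%:E) (dyadic_cell t a) <=
   (n%:R * (6 * 2 ^ l)%:R)%:E)%E.
Proof.
move=> lc; have /andP[_ tl] := on_cell_level lc.
apply: ge_ereal_sup => _ [_ [l1 [c1 [lc1 ->]]] [_ [l2 [c2 [lc2 ->]]] <-]].
rewrite lee_fin; apply: ler_eucl_dist => i.
(* The offset from the corner is at most [3 * 2 ^ l'], and [l' <= t <= l + 1]; hence the constant
   6. *)
have bnd l' c' : on_cell t a l' c' ->
    (2 * (2 ^ t * a i) <= 2 ^ l' * (c' i).*2.+1 <= 2 * (2 ^ t * a i) + 6 * 2 ^ l)%N.
  move=> lc'; have /andP[h1 h2] := on_cell_pos i lc'.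
  have /andP[l't _] := on_cell_level lc'.
  have : (2 ^ l' <= 2 * 2 ^ l)%N by rewrite -expnS leq_exp2l// (leq_trans l't).
  by rewrite mulnS -mul2n mulnCA; lia.
rewrite !mxE; have /andP[h1 h2] := bnd _ _ lc1; have /andP[h3 h4] := bnd _ _ lc2.
by rewrite ler_distl lerBlDr -!natrD !ler_nat; apply/andP; split; lia.
Qed.

(** A cell through a given point is determined by [n + 1] bits, so at most [2 ^ n.+1] cells share a
    point. *)
Lemma on_cell_inj t t' a a' l c : on_cell t a l c -> on_cell t' a' l c ->
  (l == t) = (l == t') -> (forall i, (c i == a i) = (c i == a' i)) ->
  t = t' /\ a = a'.
Proof.
move=> [[<- ca]|[<- ca]] [[<- ca']|[<- ca']].
- move=> _ e; split => //; apply/funext => i.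
  by have := e i; have := ca i; have := ca' i; do 2 case: eqP; lia.
- by rewrite eqxx => /esym/eqP; lia.
- by rewrite eqxx => /eqP; lia.
- by move=> _ _; split => //; apply/funext => i; rewrite -ca -ca'.
Qed.

Variables T N : nat.
Local Notation I := ('I_T.+1 * {ffun 'I_n -> 'I_N.+1})%type.

Definition dyadic_family (v : I) : set 'rV[R]_n :=
  dyadic_cell v.1 (fun i => v.2 i).

Definition packing_bound (u : {nonneg R}) : {nonneg R} :=
  (2 ^ n.+1 * ((Num.trunc ((6 * n)%:R * u%:num)).+1.*2.+1) ^ n)%:R%:nng.

Lemma space_filling_dyadic_family : (0 < n)%N ->
  space_filling packing_bound (@eucl_dist R n) dyadic_family.
Proof.
move=> n0; split=> [v|r s x J _ Jsr].
  apply: (@le_lt_trans _ _ (n%:R * (6 * 2 ^ T)%:R)%:E); last exact: ltry.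
  apply: ge_ereal_sup => p [q [l [c [lc qE]]] [q' q'v pE]].
  apply: (@le_trans _ _ (n%:R * (6 * 2 ^ l)%:R)%:E).
    apply: le_trans (diam_dyadic_cell lc).
    by apply: ereal_sup_ubound; exists q; [exists l, c|exists q'].
  rewrite lee_fin ler_wpM2l// ler_nat leq_mul2l leq_exp2l//=.
  have /andP[lt _] := on_cell_level lc.
  exact: leq_trans lt (leq_ord v.1).
set K := (Num.trunc ((6 * n)%:R * (r%:num / s%:num) : R)).+1.
have [w wP] : {w : I -> nat * ('I_n -> nat) & forall v, v \in J ->
    on_cell v.1 (fun i => v.2 i) (w v).1 (w v).2 /\
    eucl_dist x (dyadic_pt (w v).1 (w v).2) <= r%:num}.
  have /choice[w wP] : forall v : I, exists lc : nat * ('I_n -> nat), v \in J ->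
    on_cell v.1 (fun i => v.2 i) lc.1 lc.2 /\
    eucl_dist x (dyadic_pt lc.1 lc.2) <= r%:num.
    move=> v; have [vJ|] := boolP (v \in J); last by exists (0%N, fun=> 0%N).
    by have [_ [_ [[l [c [lc ->]]] xlc]]] := Jsr v vJ; exists (l, c).
  by exists w.
pose p v := dyadic_pt (w v).1 (w v).2.
(* A cell of diameter at least [s] has only points with [2 ^ l >= s / (6 * n)], so distinct chosen
   points differ by at least [dl] in some coordinate. *)
pose dl : R := s%:num / (6 * n)%:R.
have n6 : 0 < (6 * n)%:R :> R by rewrite ltr0n muln_gt0.
have dl0 : 0 < dl by rewrite divr_gt0.
have dlw v : v \in J -> dl <= (2 ^ (w v).1)%:R.
  move=> vJ; have [lc _] := wP v vJ; have [sv _] := Jsr v vJ.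
  have := le_trans sv (diam_dyadic_cell lc).
  by rewrite lee_fin ler_pdivrMr// -!natrM mulnC -mulnA mulnCA.
pose z v i := (p v ord0 i - x ord0 i) / dl + K%:R.
have z_itv v i : v \in J -> 0 <= z v i < (K.*2)%:R.
  move=> vJ; have [_ /(le_trans (ler_coord_eucl_dist _ _ i))] := wP v vJ.
  rewrite distrC -/(p v) => pr.
  have : `|(p v ord0 i - x ord0 i) / dl| < K%:R.
    rewrite normrM (gtr0_norm (x := dl^-1)) ?invr_gt0//.
    apply: le_lt_trans (truncnS_gt _).
    rewrite ler_pdivrMr// /dl; apply: le_trans pr _.
    rewrite le_eqVlt; apply/orP; left; apply/eqP; field.
    by rewrite pnatr_eq0 -lt0n n0 gt_eqF.
  by rewrite ltr_norml /z -addnn natrD => /andP[]; lra.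
(* Rounding at mesh [dl] determines the chosen point, and the bits then determine the cell. The
   shift by [K] in [z] keeps the rounded numbers nonnegative. *)
pose code v := ((((w v).1 == v.1), [ffun i => (w v).2 i == v.2 i]),
   [ffun i => inord (Num.trunc (z v i)) : 'I_K.*2.+1]).
have code_inj : {in J &, injective code}.
  move=> v v' vJ v'J [lv /ffunP cv /ffunP zv].
  have : (w v).1 = (w v').1 /\ (w v).2 = (w v').2.
    apply: dyadic_pt_sep => // i; rewrite -/(p v) -/(p v').
    suff lt : `|p v ord0 i - p v' ord0 i| < dl.
      by split; apply: lt_le_trans lt _; exact: dlw.
    have /andP[z0 zK] := z_itv v i vJ; have /andP[z0' zK'] := z_itv v' i v'J.
    have tK (y : R) : 0 <= y < (K.*2)%:R -> (Num.trunc y < K.*2.+1)%N.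
      by move=> /andP[y0 yK]; rewrite ltnS ltnW// truncn_lt_nat.
    have := zv i; rewrite !ffunE => /(congr1 val).
    rewrite /= !inordK ?tK ?z_itv// => tt'.
    have /andP[h1 h2] := truncn_itv z0; have /andP[h3 h4] := truncn_itv z0'.
    rewrite tt' in h1 h2.
    rewrite -[ltRHS]mul1r -ltr_pdivrMr// -[dl in ltLHS]gtr0_norm// -normfV -normrM.
    rewrite (_ : _ * _ = z v i - z v' i); last by rewrite /z; ring.
    by move: h1 h2 h3 h4; rewrite -!natr1 ltr_norml => h1 h2 h3 h4;
      apply/andP; split; lra.
  have [lc _] := wP v vJ; have [lc' _] := wP v' v'J.
  case=> e1 e2; rewrite e1 e2 in lc lv cv.
  have [] := on_cell_inj lc lc' lv.
    by move=> i; have := cv i; rewrite !ffunE.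
  case: v v' {vJ v'J lv cv zv e1 e2 lc lc'} => [t a] [t' a'] /= /val_inj -> aa'.
  by congr pair; apply/ffunP => i; apply: val_inj; have := congr1 (fun f => f i) aa'.
rewrite -(card_in_imset code_inj) ler_nat.
apply: (@leq_trans (2 ^ n.+1 * K.*2.+1 ^ n)) => //; apply: leq_trans (max_card _) _.
by rewrite !card_prod !card_ffun !card_ord card_bool expnS.
Qed.

End DyadicCells.

(** * Mapping a Euclidean grid to the dyadic graph *)

Section HyperbolicGrid.
Variables (R : realType) (n T N : nat).
Hypothesis n_gt0 : (0 < n)%N.
Local Notation G := (inter_graph (@dyadic_family R n T N)).

Lemma dyadic_edgeP (v w : vertex G) : edge v w -> exists l c,
  on_cell v.1 (fun i => v.2 i) l c /\ on_cell w.1 (fun i => w.2 i) l c.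
Proof.
move=> /andP[_ /asboolP[_ [[l [c [vlc ->]]] [l' [c' [wlc /dyadic_pt_inj]]]]]].
by move=> /(_ n_gt0)[ll' cc']; exists l, c; split=> //; rewrite ll' cc'.
Qed.

Lemma dyadic_edge_level (v w : vertex G) : edge v w -> (w.1 <= v.1 + 1)%N.
Proof.
move=> /dyadic_edgeP[l [c [/on_cell_level/andP[lv _] /on_cell_level/andP[_ wl]]]].
by rewrite addn1 (leq_trans wl).
Qed.

Lemma dyadic_edge_pos (v w : vertex G) j : edge v w ->
  (2 ^ w.1 * w.2 j <= 2 ^ v.1 * v.2 j + 2 ^ T)%N.
Proof.
move=> /dyadic_edgeP[l [c [vlc wlc]]].
have /andP[_ vc] := on_cell_pos j vlc; have /andP[wc _] := on_cell_pos j wlc.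
have /andP[lv _] := on_cell_level vlc.
apply: leq_trans wc (leq_trans vc _); rewrite leq_add2l leq_exp2l//.
exact: leq_trans lv (leq_ord v.1).
Qed.

Lemma dyadic_reach1 (v w : vertex G) l c :
  on_cell v.1 (fun i => v.2 i) l c -> on_cell w.1 (fun i => w.2 i) l c -> reach 1 v w.
Proof.
move=> vlc wlc; have [->|vw] := eqVneq v w; first exact: reach_refl.
apply: reach_edge; rewrite /= /inter_edge vw; apply/asboolP.
by exists (dyadic_pt R l c); split; exists l, c.
Qed.

Definition grid_level (x : {ffun 'I_n.+1 -> nat}) := minn (x ord0) T.

(** Coordinate 0 is the level and the others are the position, rounded down to a cube of that level;
    capping at [T] and [N] keeps each [inord] in range. *)
Definition grid_vertex (x : {ffun 'I_n.+1 -> nat}) : vertex G :=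
  (inord (grid_level x),
   [ffun i => inord (minn (x (lift ord0 i)) N %/ 2 ^ grid_level x)]).

Lemma grid_vertex1 x : (grid_vertex x).1 = grid_level x :> nat.
Proof. by rewrite /= inordK// ltnS geq_minr. Qed.

Lemma grid_vertex2 x i :
  (grid_vertex x).2 i = (minn (x (lift ord0 i)) N %/ 2 ^ grid_level x)%N :> nat.
Proof. by rewrite ffunE inordK// ltnS (leq_trans (leq_div _ _)) ?geq_minr. Qed.

(** The walk first changes the level at the position of [x], reaching [z], then moves to a touching
    cube of the level of [y]. *)
Lemma grid_vertex_cell (x y : {ffun 'I_n.+1 -> nat}) :
  (forall i, x i <= y i <= (x i).+1)%N -> reach 2 (grid_vertex x) (grid_vertex y).
Proof.
move=> xy; have minxy i : (minn (x (lift ord0 i)) N <= minn (y (lift ord0 i)) N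
    <= (minn (x (lift ord0 i)) N).+1)%N by have := xy (lift ord0 i); lia.
have divS a b k : (a <= b <= a.+1)%N -> (a %/ 2 ^ k <= b %/ 2 ^ k <= (a %/ 2 ^ k).+1)%N.
  move=> /andP[ab ba]; rewrite leq_div2r//=.
  have -> : (a %/ 2 ^ k).+1 = ((a + 2 ^ k) %/ 2 ^ k)%N.
    by rewrite divnDr// divnn expn_gt0 addn1.
  by rewrite leq_div2r// (leq_trans ba)// -addn1 leq_add2l expn_gt0.
have lxy : (grid_level y == grid_level x) || (grid_level y == (grid_level x).+1).
  by have := xy ord0; rewrite /grid_level; lia.
pose c i := (minn (y (lift ord0 i)) N %/ 2 ^ grid_level x)%N.
pose z : vertex G :=
  if grid_level y == grid_level x then grid_vertex x else
  ((grid_vertex y).1, [ffun i => inord (minn (x (lift ord0 i)) N %/ 2 ^ grid_level y)]).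
have z2 i : z.2 i = (minn (x (lift ord0 i)) N %/ 2 ^ grid_level y)%N :> nat.
  rewrite /z; case: eqP => [->|_]; first exact: grid_vertex2.
  by rewrite /= ffunE inordK// ltnS (leq_trans (leq_div _ _)) ?geq_minr.
have z1 : z.1 = grid_level y :> nat.
  by rewrite /z; case: eqP => [->|_]; exact: grid_vertex1.
apply: (@reach_trans _ 1 1 _ z).
  case/orP: lxy => [lxy|/eqP lxy]; first by rewrite /z lxy; exact: reach_refl.
  apply: (@dyadic_reach1 _ _ (grid_level x)
    (fun i => minn (x (lift ord0 i)) N %/ 2 ^ grid_level x)%N).
    by left; rewrite grid_vertex1; split=> // i; rewrite grid_vertex2 leqnn leqnSn.
  right; rewrite z1 lxy; split=> // i.
  by rewrite z2 lxy expnSr divnMA divn2.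
apply: (@dyadic_reach1 _ _ (grid_level y)
  (fun i => minn (y (lift ord0 i)) N %/ 2 ^ grid_level y)%N).
  by left; rewrite z1; split=> // i; rewrite z2; exact: divS.
by left; rewrite grid_vertex1; split=> // i; rewrite grid_vertex2 leqnn leqnSn.
Qed.

(** [D] edges climb at most [D < T] levels and shift a position by at most [D * 2 ^ T], while
    rounding takes less than [2 ^ T] from [N]. *)
Lemma grid_vertex_faces D : T = D.+1 -> N = (D.+1 * 2 ^ T)%N ->
  forall (i : 'I_n.+1) (y z : {ffun 'I_n.+1 -> nat}),
  y i = 0%N -> z i = N -> ~ reach D (grid_vertex y) (grid_vertex z).
Proof.
move=> TE NE i y z yi zi yz.
have [j ij|i0] := unliftP ord0 i.
  have := reach_lipschitz (fun v w => @dyadic_edge_pos v w j) yz.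
  rewrite !grid_vertex1 !grid_vertex2 -ij yi zi min0n div0n muln0 add0n minnn.
  have : (2 ^ grid_level z <= 2 ^ T)%N by rewrite leq_exp2l// geq_minr.
  have := divn_eq N (2 ^ grid_level z).
  have : (N %% 2 ^ grid_level z < 2 ^ grid_level z)%N by rewrite ltn_pmod ?expn_gt0.
  by rewrite {3}NE mulSn mulnC; clear; lia.
have := reach_lipschitz dyadic_edge_level yz.
rewrite !grid_vertex1 /grid_level -i0 yi zi min0n add0n muln1.
have TN : (T <= N)%N by rewrite NE TE leq_pmulr// expn_gt0.
by rewrite (minn_idPr TN) TE ltnn.
Qed.

End HyperbolicGrid.

Theorem theorem1p4 (R : realType) (n : nat) (n_gt0 : (0 < n)%N) :
  exists f : {nonneg R} -> {nonneg R},
    ((n.+1)%:R%:E <= asdim R (space_filling_graphs n f))%E.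
Proof.
exists (@packing_bound R n); apply/ereal_infP => _ [m [g gP] <-].
rewrite lee_fin ler_nat ltnNge; apply/negP => mn.
have [r r4] : exists r, (4 <= r)%N by exists 4%N.
have [D gD] : exists D : nat, (g r%:R%:nng)%:num < D%:R.
  by eexists; exact: truncnS_gt.
(* The faces must be more than [D + 4] apart: a member of diameter below [D] and two approaches of
   length 2. *)
pose T := (D + 4).+1; pose N := ((D + 4).+1 * 2 ^ T)%N.
apply: (@not_control_function R (inter_graph (@dyadic_family R n T N)) n N D m r
  (@grid_vertex R n T N) g) => //.
- by rewrite muln_gt0 expn_gt0.
- exact: grid_vertex_cell.
- exact: grid_vertex_faces.
- apply: gP; exists ('I_T.+1 * {ffun 'I_n -> 'I_N.+1})%type, (@dyadic_family R n T N).
  by split => //; exact: space_filling_dyadic_family.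
Qed.
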